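(* Let $n\ge 2$. The number of interlaced chains (interlaced unions of chains) with $n$ coordinates and smallest coordinate equal to $1$ is equal to $2^{n-2}$.
   Context: A chain is a set of integers $\{c,c-2,\dots,c-2k\}$ with $c,k\in\mathbb{Z}$, $k\ge0$. Two chains $\{A,\dots,a\}$ and $\{B,\dots,b\}$ (largest and smallest entries displayed) are linked if their entries are disjoint and $A>B>a$ or $B>A>b$. A union of chains $\bigcup_{i\in I}\mathcal{C}_i$ with pairwise disjoint entries (regarded as the unordered collection of the chains $\mathcal{C}_i$, so that, e.g., $\{4,2\}$ as one chain differs from $\{4\}\cup\{2\}$ as two chains) is interlaced if for all $i\ne j$ in $I$ there are indices $i=i_0,i_1,\dots,i_r=j$ in $I$ with $\mathcal{C}_{i_{l-1}}$ and $\mathcal{C}_{i_l}$ linked for all $1\le l\le r$; a single chain is interlaced. The coordinates (entries) of the union are all the entries of its chains. *)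

(* Defs.v *)
From mathcomp Require Import all_boot all_order all_algebra finmap.
From mathcomp Require Import classical_sets cardinality.
Set Implicit Arguments.
Unset Strict Implicit.
Unset Printing Implicit Defensive.
Import Order.TTheory GRing.Theory Num.Theory.
Local Open Scope fset_scope.
Local Open Scope ring_scope.

Definition chain_set (c : int) (k : nat) : {fset int} :=
  [fset c - 2 * i%:Z | i in iota 0 k.+1].

Definition is_chain (C : {fset int}) : Prop :=
  exists (c : int) (k : nat), C = chain_set c k.

(* A chain determines its largest entry A and its smallest entry A - 2k, so
   the existential quantifiers only name these entries. *)
Definition linked (C D : {fset int}) : Prop :=
  exists (A : int) (k : nat) (B : int) (l : nat),
    [/\ C = chain_set A k, D = chain_set B l, [disjoint C & D] &
        (A - 2 * k%:Z < B < A) \/ (B - 2 * l%:Z < A < B)].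

(* An unordered collection of pairwise disjoint chains is encoded as the finite
   set of its chains: chains are nonempty, so disjointness makes the members of
   an indexed family distinct. *)
Definition chain_union (U : {fset {fset int}}) : Prop :=
  (forall C, C \in U -> is_chain C) /\
  (forall C D, C \in U -> D \in U -> C != D -> [disjoint C & D]).

Definition coordinates (U : {fset {fset int}}) : {fset int} := fcover U.

Definition interlaced (U : {fset {fset int}}) : Prop :=
  chain_union U /\
  forall C D, C \in U -> D \in U -> C != D ->
    exists (r : nat) (x : nat -> {fset int}),
      [/\ x 0%N = C, x r = D,
          (forall l, (l <= r)%N -> x l \in U) &
          (forall l, (1 <= l <= r)%N -> linked (x l.-1) (x l))].

Definition smallest_coordinate (U : {fset {fset int}}) (m : int) : Prop :=
  m \in coordinates U /\ (forall y, y \in coordinates U -> m <= y).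

(* Main.v *)
(* Let M be the largest coordinate of an interlaced union with n >= 2
   coordinates. Its chain contains M - 2, and exactly two moves add a coordinate:
   append M + 2 to the chain of M, or fill the slot next to it, that is append
   M + 1 to the chain of M - 1 if M - 1 is a coordinate, and otherwise add the
   one-element chain {M - 1}. Both moves preserve interlacedness, and every
   interlaced union with n + 1 coordinates arises from exactly one of them in
   exactly one way: the first move was made iff the predecessor of the new
   largest coordinate is not a coordinate. So the
   number doubles with each coordinate, starting from the single chain {3, 1}. *)
Require Import Defs.
From mathcomp Require Import all_boot all_order all_algebra finmap.
From mathcomp Require Import classical_sets cardinality.
From mathcomp Require Import zify.
Set Implicit Arguments.
Unset Strict Implicit.
Unset Printing Implicit Defensive.
Import Order.TTheory GRing.Theory Num.Theory.
Local Open Scope fset_scope.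
Local Open Scope ring_scope.

(** * Entries of chains, and adding or removing the top entry *)

Lemma coordinatesP (U : {fset {fset int}}) x :
  reflect (exists2 C, C \in U & x \in C) (x \in coordinates U).
Proof.
apply: (iffP (bigfcupP _ _ _ _)) => [[C /andP[CU _] xC]|[C CU xC]];
  by exists C; rewrite ?CU.
Qed.

Lemma in_chain_set x c k :
  reflect (exists2 j : int, 0 <= j <= k%:Z & x = c - 2 * j)
    (x \in chain_set c k).
Proof.
apply: (iffP (imfsetP _ _ _ _)) => [[i /=]|[j jk ->]].
  by rewrite inE => iI ->; move: iI; rewrite mem_iota; exists i%:Z; lia.
by exists `|j|%N; rewrite /= ?inE ?mem_iota; lia.
Qed.

Lemma chain_congr (C : {fset int}) x y :
  is_chain C -> x \in C -> y \in C -> exists j : int, y = x + 2 * j.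
Proof.
move=> [c [k ->]] /in_chain_set[i _ ->] /in_chain_set[j _ ->].
by exists (i - j); lia.
Qed.

(** Since [x - 2] is an entry and [x] is not, [x - 2] must be the top of [C], so [x] prolongs the
    chain upwards. *)
Lemma chain_add (C : {fset int}) x :
  is_chain C -> x - 2 \in C -> x \notin C -> is_chain (x |` C).
Proof.
move=> [c [k ->]] /in_chain_set[i ik xE] xC.
have i0 : i = 0.
  case: (ltP 0 i) => i0; last by lia.
  by case/in_chain_set: xC; exists (i - 1); lia.
exists x, k.+1; apply/fsetP => y; rewrite !inE.
apply/orP/in_chain_set => [[/eqP->|/in_chain_set[j jk ->]]|[j jk ->]].
- by exists 0; lia.
- by exists (j + 1); lia.
- have [->|j0] := eqVneq j 0; first by left; apply/eqP; lia.
  by right; apply/in_chain_set; exists (j - 1); lia.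
Qed.

Lemma chain_remove (C : {fset int}) x :
  is_chain C -> x \in C -> (forall y, y \in C -> y <= x) -> C != [fset x] ->
  is_chain (C `\ x) /\ x - 2 \in C.
Proof.
move=> [c [k ->]] /in_chain_set[i ik ->] xmax.
have -> : i = 0.
  have /xmax : c \in chain_set c k by apply/in_chain_set; exists 0; lia.
  by lia.
rewrite mulr0 subr0; case: k {ik xmax} => [/eqP[]|k _].
  apply/fsetP => y; rewrite !inE; apply/in_chain_set/eqP => [[j]|->]; first lia.
  by exists 0; lia.
split; last by apply/in_chain_set; exists 1; lia.
exists (c - 2), k; apply/fsetP => y; rewrite !inE.
apply/andP/in_chain_set => [[yc /in_chain_set[j jk yE]]|[j jk ->]].
  by exists (j - 1); lia.
by split; [lia|apply/in_chain_set; exists (j + 1); lia].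
Qed.

Lemma chain_pair x : is_chain [fset x; x + 2].
Proof.
exists (x + 2), 1%N; apply/fsetP => y; rewrite !inE.
apply/orP/in_chain_set => [[/eqP->|/eqP->]|[j j1 ->]].
- by exists 1; lia.
- by exists 0; lia.
by have [->|j0] := eqVneq j 0; [right|left]; apply/eqP; lia.
Qed.

Lemma chain_single x : is_chain [fset x].
Proof.
exists x, 0%N; apply/fsetP => y; rewrite !inE.
by apply/eqP/in_chain_set => [->|[j]]; [exists 0|]; lia.
Qed.

(** * Links between chains, described by neighbouring entries *)

(** A local form of linkedness: it names three consecutive integers instead of the endpoints of the
    chains, so it can be followed when entries are added or deleted. *)
Definition straddles (C D : {fset int}) : Prop :=
  exists y, [/\ y \in C, y - 1 \in D & y + 1 \in D].

Definition overlap (C D : {fset int}) : Prop :=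
  [/\ is_chain C, is_chain D & straddles C D \/ straddles D C].

Lemma overlapC C D : overlap C D -> overlap D C.
Proof. by case=> ? ? []; split; auto. Qed.

Lemma linkedC C D : linked C D -> linked D C.
Proof.
move=> [A [k [B [l [-> -> dis h]]]]]; exists B, l, A, k.
by split; rewrite 1?fdisjoint_sym //; tauto.
Qed.

(** The entries [y] and [y - 1] show that the chains have opposite parity, hence are disjoint.
    Whichever chain has the smaller top, that top lies strictly between the endpoints of the
    other. *)
Lemma straddles_linked C D :
  is_chain C -> is_chain D -> straddles C D -> linked C D.
Proof.
move=> cC cD [y [yC y1 y2]].
have dis : [disjoint C & D].
  apply/fdisjointP => z zC; apply/negP => zD.
  by have [[i ?] [j ?]] := (chain_congr cC yC zC, chain_congr cD y1 zD); lia.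
move: cC cD yC y1 y2 dis => [A [k ->]] [B [l ->]] yC y1 y2 dis.
exists A, k, B, l; split=> //.
move: yC y1 y2 => /in_chain_set[i ik ?] /in_chain_set[j jl ?].
by move=> /in_chain_set[j' jl' ?]; have [AB|AB] := ltP A B; lia.
Qed.

(** If [A] and [B] had the same parity, [B] would be an entry of the chain of [A]. So the parities
    differ, and both neighbours of [B] are entries of that chain. *)
Lemma between_straddles A k B l : [disjoint chain_set A k & chain_set B l] ->
  A - 2 * k%:Z < B < A -> straddles (chain_set B l) (chain_set A k).
Proof.
move=> dis BA.
have BB : B \in chain_set B l by apply/in_chain_set; exists 0; lia.
have odd : ((A - B) %% 2)%Z != 0.
  apply/eqP => ev; have := dis; rewrite fdisjoint_sym => /fdisjointP/(_ _ BB).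
  by move/negP; apply; apply/in_chain_set; exists ((A - B) %/ 2)%Z; lia.
exists B; split=> //; apply/in_chain_set.
  by exists ((A - B + 1) %/ 2)%Z; lia.
by exists ((A - B - 1) %/ 2)%Z; lia.
Qed.

Lemma linkedP C D : linked C D <-> overlap C D.
Proof.
split=> [[A [k [B [l [-> -> dis h]]]]]|[cC cD [|/straddles_linked h]]].
- split; [by exists A, k|by exists B, l|].
  case: h => [/(between_straddles dis)|]; first by right.
  by left; apply: between_straddles; rewrite 1?fdisjoint_sym.
- exact: straddles_linked.
- exact/linkedC/h.
Qed.

(** * Connectedness of a union of chains *)

(** Connectedness as an induction principle: a property that passes along links spreads from one
    chain to all. This replaces explicit paths in the later arguments. *)
Definition connected (U : {fset {fset int}}) : Prop :=
  forall P : {fset int} -> Prop,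
    (forall C D, C \in U -> D \in U -> overlap C D -> P C -> P D) ->
    forall C D, C \in U -> D \in U -> P C -> P D.

Lemma interlacedP U : interlaced U <-> chain_union U /\ connected U.
Proof.
split=> -[cU conn]; split=> //.
  move=> P Pl C D CU DU PC; have [<- //|CD] := eqVneq C D.
  have [r [x [x0 <- xU xl]]] := conn _ _ CU DU CD.
  suff: forall l, (l <= r)%N -> P (x l) by apply.
  elim=> [|l IH] lr; first by rewrite x0.
  apply: (Pl (x l)); rewrite ?xU //; [exact: ltnW| |exact/IH/ltnW].
  exact/linkedP/(xl l.+1).
move=> C D CU DU _.
(* The property to spread is reachability from [C] by a path; one more link appends its endpoint to
   the path. *)
apply: (conn (fun D => exists (r : nat) (x : nat -> {fset int}),
      [/\ x 0%N = C, x r = D,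
          (forall l, (l <= r)%N -> x l \in U) &
          (forall l, (1 <= l <= r)%N -> linked (x l.-1) (x l))])
       _ C D) => //; last first.
  by exists 0%N, (fun=> C); split=> // l; lia.
move=> E F EU FU EF [r [x [x0 xr xU xl]]].
exists r.+1, (fun l => if (l <= r)%N then x l else F); rewrite ltnn.
split=> // l; first by case: (leqP l r) => // lr _; exact: xU.
move=> /andP[l0]; rewrite leq_eqVlt => /predU1P[->|lr].
  by rewrite /= leqnn ltnn xr; exact/linkedP.
have [-> ->] : (l <= r)%N /\ (l.-1 <= r)%N by lia.
by apply: xl; rewrite l0.
Qed.

(* Links may collapse to a point, as when a leaf is merged with its neighbour. *)
Lemma connected_image (U V : {fset {fset int}}) (f : {fset int} -> {fset int}) :
  (forall C, C \in U -> f C \in V) ->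
  (forall D, D \in V -> exists2 C, C \in U & D = f C) ->
  (forall C D, C \in U -> D \in U -> overlap C D ->
     overlap (f C) (f D) \/ f C = f D) ->
  connected U -> connected V.
Proof.
move=> fV fsurj fl conn P Pl _ _ /fsurj[C CU ->] /fsurj[D DU ->].
apply: (conn (fun C => P (f C))) => // E F EU FU EF.
by case: (fl _ _ EU FU EF) => [|<- //]; apply: Pl; exact: fV.
Qed.

(** A property passes between [C] and [D] in both directions, so [C] exchanges it with any other
    chain by way of [D]. *)
Lemma connected_leaf (U : {fset {fset int}}) C D :
  connected U -> D \in U -> overlap C D -> connected (C |` U).
Proof.
move=> conn DU CD P Pl E F.
have CV : C \in C |` U by rewrite !inE eqxx.
have inV G : G \in U -> G \in C |` U by move=> GU; rewrite !inE GU orbT.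
have {}conn G H : G \in U -> H \in U -> P G -> P H.
  by apply: (conn P) => G' H' G'U H'U; apply: Pl; exact: inV.
have PD : P C -> P D by apply: (Pl C D CV (inV D DU)).
have PC : P D -> P C by apply: (Pl D C (inV D DU) CV); exact: overlapC.
rewrite !inE => /predU1P[->|EU] /predU1P[->|FU] //.
- by move=> /PD; exact: conn.
- by move=> PE; apply/PC/(conn _ _ EU DU PE).
- exact: conn.
Qed.

Lemma chain_union_eq (U : {fset {fset int}}) (C D : {fset int}) x :
  chain_union U -> C \in U -> D \in U -> x \in C -> x \in D -> C = D.
Proof.
move=> [_ dis] CU DU xC xD; apply/eqP/negPn/negP => /(dis _ _ CU DU).
by move/fdisjointP/(_ _ xC); rewrite xD.
Qed.

(** * Adding and deleting the largest coordinate of a chain *)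

(** Among disjoint chains at most one contains [x - 2], so mapping [extend x] over a union alters at
    most one chain; a uniform map is what [connected_image] takes. *)
Definition extend (x : int) (C : {fset int}) : {fset int} :=
  if x - 2 \in C then x |` C else C.

Definition grow (x : int) (U : {fset {fset int}}) : {fset {fset int}} :=
  [fset extend x C | C in U].

(** Applied below when [x] is the largest coordinate and is not a chain by itself, so that no chain
    becomes empty. *)
Definition shrink (x : int) (U : {fset {fset int}}) : {fset {fset int}} :=
  [fset C `\ x | C in U].

Lemma in_extend x C y :
  (y \in extend x C) = (y == x) && (x - 2 \in C) || (y \in C).
Proof. by rewrite /extend; case: ifP => _; rewrite ?inE ?andbT ?andbF. Qed.

Lemma extendK x C : x \notin C -> extend x C `\ x = C.
Proof.
move=> xC; apply/fsetP => y; rewrite !inE in_extend.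
by case: eqVneq => [->|] //=; rewrite (negPf xC).
Qed.

Lemma extend_chain x C : is_chain C -> x \notin C -> is_chain (extend x C).
Proof. by move=> cC xC; rewrite /extend; case: ifP => // *; apply: chain_add. Qed.

Lemma remove_notin x (C : {fset int}) : x \notin C -> C `\ x = C.
Proof.
move=> xC; apply/fsetP => y; rewrite !inE.
by case: eqVneq => [->|] //=; rewrite (negPf xC).
Qed.

Section Grow.

Variables (x : int) (U : {fset {fset int}}).
Hypothesis xU : x \notin coordinates U.

Let xNin C : C \in U -> x \notin C.
Proof. by move=> CU; apply: contra xU => xC; apply/coordinatesP; exists C. Qed.

Lemma coordinates_grow :
  x - 2 \in coordinates U -> coordinates (grow x U) = x |` coordinates U.
Proof.
move=> /coordinatesP[D DU xD]; apply/fsetP => y; rewrite !inE.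
apply/coordinatesP/predU1P => [[_ /imfsetP[/= C CU ->]]|].
  rewrite in_extend => /orP[/andP[/eqP-> _]|yC]; first by left.
  by right; apply/coordinatesP; exists C.
case=> [->|/coordinatesP[C CU yC]].
  by exists (extend x D); rewrite ?in_imfset // in_extend eqxx xD.
by exists (extend x C); rewrite ?in_imfset // in_extend yC orbT.
Qed.

Lemma growK : shrink x (grow x U) = U.
Proof.
apply/fsetP => C; apply/imfsetP/idP => [[/= _ /imfsetP[/= D DU ->] ->]|CU].
  by rewrite extendK ?xNin.
by exists (extend x C); rewrite ?in_imfset // extendK ?xNin.
Qed.

Lemma chain_union_grow : chain_union U -> chain_union (grow x U).
Proof.
move=> uU; split=> [_ /imfsetP[/= C CU ->]|].
  by apply: extend_chain; [exact: uU.1|exact: xNin].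
move=> _ _ /imfsetP[/= C CU ->] /imfsetP[/= D DU ->] CD.
apply/fdisjointP => y; rewrite !in_extend => yC; apply: contra CD => yD.
apply/eqP; congr extend; have [yx|yx] := eqVneq y x.
  move: yC yD; rewrite yx eqxx (negPf (xNin CU)) (negPf (xNin DU)) !orbF /=.
  exact: (chain_union_eq uU CU DU).
by move: yC yD; rewrite (negPf yx); exact: (chain_union_eq uU CU DU).
Qed.

(** Extending chains only adds entries, so every straddling survives. *)
Lemma interlaced_grow : interlaced U -> interlaced (grow x U).
Proof.
move=> /interlacedP[uU cU]; apply/interlacedP; split.
  exact: chain_union_grow.
have extS C y : y \in C -> y \in extend x C by rewrite in_extend => ->; rewrite orbT.
have strS C D : straddles C D -> straddles (extend x C) (extend x D).
  by move=> [y [? ? ?]]; exists y; split; exact: extS.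
apply: (connected_image (f := extend x)) cU => [C CU|D|C D CU DU [cC cD CD]].
- by apply: in_imfset.
- by case/imfsetP => C /= CU ->; exists C.
left; split; [exact/extend_chain/xNin|exact/extend_chain/xNin|].
by case: CD => /strS; auto.
Qed.

End Grow.

Section Shrink.

Variables (x : int) (V : {fset {fset int}}).
Hypotheses (uV : chain_union V) (xV : x \in coordinates V).
Hypothesis x_max : forall y, y \in coordinates V -> y <= x.
Hypothesis xNV : [fset x] \notin V.

Let xge C y : C \in V -> y \in C -> y <= x.
Proof. by move=> CV yC; apply: x_max; apply/coordinatesP; exists C. Qed.

Lemma remove_top C : C \in V -> x \in C -> is_chain (C `\ x) /\ x - 2 \in C.
Proof.
move=> CV xC; apply: chain_remove => //; first exact: uV.1.
  by move=> y; exact: xge.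
by apply: contraNneq xNV => <-.
Qed.

Lemma remove_chain C : C \in V -> is_chain (C `\ x).
Proof.
move=> CV; have [/(remove_top CV)[]//|xC] := boolP (x \in C).
by rewrite remove_notin //; exact: uV.1.
Qed.

(** This lets [extend] recognise, after [x] has been deleted, the chain to which [x] belonged. *)
Lemma top_pred C : C \in V -> (x - 2 \in C) = (x \in C).
Proof.
move=> CV; apply/idP/idP => [|/(remove_top CV)[]//].
have /coordinatesP[D DV xD] := xV.
move: (xD) => /(remove_top DV)[_ xD2] xC2.
by rewrite (chain_union_eq uV CV DV xC2 xD2).
Qed.

Lemma in_coordinates_shrink y :
  (y \in coordinates (shrink x V)) = (y != x) && (y \in coordinates V).
Proof.
apply/coordinatesP/andP => [[_ /imfsetP[/= C CV ->]]|].
  by rewrite !inE => /andP[? yC]; split=> //; apply/coordinatesP; exists C.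
move=> [yx /coordinatesP[C CV yC]].
by exists (C `\ x); [apply/imfsetP; exists C|rewrite !inE yx].
Qed.

Lemma shrinkK : grow x (shrink x V) = V.
Proof.
have ext C : C \in V -> extend x (C `\ x) = C.
  move=> CV; apply/fsetP => y; rewrite in_extend !inE top_pred //.
  by case: (eqVneq y x) => [->|] /=; case: eqVneq; rewrite ?orbF //; lia.
apply/fsetP => C; apply/imfsetP/idP => [[/= _ /imfsetP[/= D DV ->] ->]|CV].
  by rewrite ext.
by exists (C `\ x); [apply/imfsetP; exists C|rewrite ext].
Qed.

Lemma chain_union_shrink : chain_union (shrink x V).
Proof.
split=> [_ /imfsetP[/= C CV ->]|]; first exact: remove_chain.
move=> _ _ /imfsetP[/= C CV ->] /imfsetP[/= D DV ->] CD.
apply/fdisjointP => y; rewrite !inE => /andP[yx yC]; rewrite yx /=.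
by apply: contra CD => yD; rewrite (chain_union_eq uV CV DV yC yD).
Qed.

(** The chain [[fset x - 1]] is excluded because it can only be linked through [x], so deleting [x]
    would isolate it. *)
Lemma connected_shrink :
  [fset x - 1] \notin V -> connected V -> connected (shrink x V).
Proof.
move=> x1V cV.
(* If the straddled entry of [D] lost its upper neighbour [x], its lower
   neighbour [x - 2] is straddled instead. *)
have str C D : C \in V -> D \in V -> straddles C D ->
    straddles (C `\ x) (D `\ x) \/ straddles (D `\ x) (C `\ x).
  move=> CV DV [y [yC y1 y2]].
  have yx := xge DV y2.
  have [yE|yE] := eqVneq (y + 1) x; last first.
    by left; exists y; rewrite !inE yC y1 y2; split; lia.
  have ymax z : z \in C -> z <= y.
    move=> zC; have := xge CV zC.
    by have [j] := chain_congr (uV.1 _ CV) yC zC; lia.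
  have [|_ yC2] := chain_remove (uV.1 _ CV) yC ymax.
    by apply: contraNneq x1V; rewrite (_ : x - 1 = y) => [<- //|]; lia.
  right; exists (y - 1); rewrite !inE y1 (_ : y - 1 - 1 = y - 2); last lia.
  by rewrite subrK yC2 yC; split; lia.
apply: (connected_image (f := fun C => C `\ x)) cV => [C CV|D|C D CV DV].
- by apply: in_imfset.
- by case/imfsetP => C /= CV ->; exists C.
move=> [_ _ CD]; left; split; [exact: remove_chain|exact: remove_chain|].
by case: CD => /str; tauto.
Qed.

End Shrink.

Lemma interlaced_neighbour U C : interlaced U -> C \in U -> U != [fset C] ->
  exists2 D, D \in U & overlap C D.
Proof.
move=> /interlacedP[_ cU] CU UC.
have /fset0Pn[D] : U `\ C != fset0.
  by apply: contra UC => /eqP U0; rewrite -(fsetD1K CU) U0 fsetU0.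
rewrite !inE => /andP[DC DU].
have [] : D = C \/ exists2 D, D \in U & overlap C D.
(* The second alternative does not depend on [E]: the first link that leaves [C] establishes it, and
   it then persists up to [D]. *)
- apply: (cU (fun E => E = C \/ _) _ C) => //; last by left.
  by move=> E F EU FU EF [EC|]; right=> //; exists F => //; rewrite -EC.
- by move/eqP; rewrite (negPf DC).
- by [].
Qed.

(** * The two moves and their inverse *)

(** The union is paired with its largest coordinate, which it determines, so that the moves can
    refer to that coordinate directly. *)
Definition valid (n : nat) (X : int * {fset {fset int}}) : Prop :=
  [/\ interlaced X.2, #|` coordinates X.2| = n, smallest_coordinate X.2 1,
      X.1 \in coordinates X.2 & forall y, y \in coordinates X.2 -> y <= X.1].

Lemma coordinates1 C : coordinates [fset C] = C.
Proof.
apply/fsetP => y; apply/coordinatesP/idP => [[D]|yC].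
  by rewrite inE => /eqP->.
by exists C; rewrite ?inE.
Qed.

(** A one-element chain cannot surround an entry of another chain, so a neighbour of [[fset M]]
    would have to contain [M + 1], above the maximum. *)
Lemma top_not_isolated n X : (2 <= n)%N -> valid n X -> [fset X.1] \notin X.2.
Proof.
case: X => M U n2 [/= iU cn _ MU Mmax]; apply/negP => MsU.
have [|D DU [_ _]] := interlaced_neighbour iU MsU.
  by apply/eqP => UE; move: cn; rewrite UE coordinates1 cardfs1; lia.
case=> -[y [/=]]; rewrite !inE; last by lia.
move=> /eqP-> _ M1; have : M + 1 \in coordinates U by apply/coordinatesP; exists D.
by move/Mmax; lia.
Qed.

Lemma coordinatesU1 C U : coordinates (C |` U) = C `|` coordinates U.
Proof.
apply/fsetP => y; rewrite !inE.
apply/coordinatesP/orP => [[D]|[yC|/coordinatesP[D DU yD]]].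
- rewrite !inE => /predU1P[->|DU] yD; first by left.
  by right; apply/coordinatesP; exists D.
- by exists C; rewrite // !inE eqxx.
- by exists D; rewrite // !inE DU orbT.
Qed.

Definition step (b : bool) (X : int * {fset {fset int}}) :
    int * {fset {fset int}} :=
  let: (M, U) := X in
  if b then (M + 2, grow (M + 2) U)
  else if M - 1 \in coordinates U then (M + 1, grow (M + 1) U)
  else (M, [fset M - 1] |` U).

(** The three branches undo, in this order, appending above a gap, filling the gap by a new
    one-element chain, and appending [M] to the chain of [M - 2] when the previous maximum was
    [M - 1]. *)
Definition unstep (Y : int * {fset {fset int}}) :
    bool * (int * {fset {fset int}}) :=
  let: (M, V) := Y in
  if M - 1 \notin coordinates V then (true, (M - 2, shrink M V))
  else if [fset M - 1] \in V then (false, (M, V `\ [fset M - 1]))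
  else (false, (M - 1, shrink M V)).

Lemma valid_pred n M U : (2 <= n)%N -> valid n (M, U) ->
  exists2 D, D \in U & (M \in D) && (M - 2 \in D).
Proof.
move=> n2 vU; have MU1 := top_not_isolated n2 vU.
have [/= [uU _] _ _ MU Mmax] := vU.
have /coordinatesP[D DU MD] := MU.
by exists D; rewrite // MD (top_pred uU MU Mmax).
Qed.

Lemma valid_grow n M N U : valid n (M, U) -> M <= N -> N \notin coordinates U ->
  N - 2 \in coordinates U -> valid n.+1 (N, grow N U).
Proof.
move=> [/= iU cn [oneU Umin] MU Mmax] MN NU N2; split=> /=.
- exact: interlaced_grow.
- by rewrite coordinates_grow // cardfsU1 NU cn.
- rewrite /smallest_coordinate coordinates_grow // !inE oneU orbT; split=> // y.
  rewrite !inE => /predU1P[->|]; last exact: Umin.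
  by have := Umin _ MU; lia.
- by rewrite coordinates_grow // !inE eqxx.
- move=> y; rewrite coordinates_grow // !inE => /predU1P[-> //|/Mmax].
  by move=> yM; exact: le_trans MN.
Qed.

Lemma valid_step n b X : (2 <= n)%N -> valid n X -> valid n.+1 (step b X).
Proof.
case: X => M U n2 vU; have [D DU /andP[MD M2D]] := valid_pred n2 vU.
have [/= iU cn [oneU Umin] MU Mmax] := vU.
have [uU cU] := (interlacedP _).1 iU.
have gtM y : M < y -> y \notin coordinates U.
  by move=> My; apply/negP => /Mmax; lia.
have M2 : M - 2 \in coordinates U by apply/coordinatesP; exists D.
case: b => /=.
  by apply: (valid_grow vU); rewrite ?gtM ?addrK //; lia.
case: ifPn => M1.
  apply: (valid_grow vU); rewrite ?gtM //; try lia.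
  by rewrite (_ : M + 1 - 2 = M - 1) //; lia.
(* The new chain sits between the entries [M - 2] and [M] of [D], so it is attached to [D] as a
   leaf. *)
have MsD : overlap [fset M - 1] D.
  split; [exact: chain_single|exact: uU.1|left; exists (M - 1)].
  by rewrite inE eqxx subrK (_ : M - 1 - 1 = M - 2) //; lia.
split=> /=.
- apply/interlacedP; split; last exact: connected_leaf cU DU MsD.
  have dis C : C \in U -> [disjoint [fset M - 1] & C].
    move=> CU; rewrite fdisjoint1X; apply: contra M1 => CM.
    by apply/coordinatesP; exists C.
  split=> [C|C E]; rewrite !inE.
    by case/predU1P => [->|/uU.1//]; exact: chain_single.
  move=> /predU1P[->|CU] /predU1P[->|EU]; rewrite ?eqxx // => CE.
  + exact: dis.
  + by rewrite fdisjoint_sym dis.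
  + exact: uU.2.
- by rewrite coordinatesU1 cardfsU1 M1 cn.
- rewrite /smallest_coordinate coordinatesU1 !inE oneU orbT; split=> // y.
  by rewrite !inE => /predU1P[->|]; [have := Umin _ M2; lia|exact: Umin].
- by rewrite coordinatesU1 !inE MU orbT.
- by move=> y; rewrite coordinatesU1 !inE => /predU1P[->|/Mmax //]; lia.
Qed.

Lemma stepK n b X : (2 <= n)%N -> valid n X -> unstep (step b X) = (b, X).
Proof.
case: X => M U n2 vU; have [D DU /andP[MD M2D]] := valid_pred n2 vU.
have [/= [uU _] cn [oneU Umin] MU Mmax] := vU.
have gtM y : M < y -> y \notin coordinates U.
  by move=> My; apply/negP => /Mmax; lia.
case: b => /=.
  have MN : M + 2 \notin coordinates U by apply: gtM; lia.
  rewrite coordinates_grow ?addrK // growK // !inE negb_or gtM; last by lia.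
  by rewrite (_ : M + 2 - 1 != M + 2) //; lia.
case: ifPn => M1 /=; last first.
  rewrite coordinatesU1 !inE eqxx /= fsetU1K ?eqxx //.
  by apply: contra M1 => M1; apply/coordinatesP; exists [fset M - 1]; rewrite ?inE.
have MN : M + 1 \notin coordinates U by apply: gtM; lia.
have M12 : M + 1 - 2 \in coordinates U by rewrite (_ : M + 1 - 2 = M - 1) //; lia.
rewrite coordinates_grow // addrK !inE MU orbT /= growK //.
(* The singleton test of [unstep] must fail: a chain containing [M] is [D], which also contains
   [M - 2]. *)
case: ifP => // /imfsetP[/= C CU CE].
have MC : M \in C.
  have : M \in extend (M + 1) C by rewrite -CE inE.
  by rewrite in_extend => /orP[/andP[/eqP]|//]; clear; lia.
have M2C : M - 2 \in C by rewrite (chain_union_eq uU CU DU MC MD).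
have : M - 2 \in [fset M] by rewrite CE in_extend M2C orbT.
by rewrite inE; clear; lia.
Qed.

Lemma unstepK n Y : (2 <= n)%N -> valid n.+1 Y ->
  valid n (unstep Y).2 /\ step (unstep Y).1 (unstep Y).2 = Y.
Proof.
case: Y => M V n2 vV.
have [M1M M2M] : M - 1 != M /\ M - 2 != M by clear; lia.
have n2' : (2 <= n.+1)%N by lia.
have MsV := top_not_isolated n2' vV.
have [D DV /andP[MD M2D]] := valid_pred n2' vV.
have [/= iV cn [oneV Vmin] MV Mmax] := vV.
have [uV cV] := (interlacedP _).1 iV.
have M2V : M - 2 \in coordinates V by apply/coordinatesP; exists D.
have inS := @in_coordinates_shrink M V.
have M2S : M - 2 \in coordinates (shrink M V) by rewrite inS M2V M2M.
(* Shared by the two branches that delete [M]; they differ only in the new maximum [N]. *)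
have vshrink N : [fset M - 1] \notin V -> N \in coordinates (shrink M V) ->
    (forall y, y \in coordinates (shrink M V) -> y <= N) ->
    valid n (N, shrink M V).
  move=> M1V NS Nmax; split=> //=.
  - apply/interlacedP; split; first exact: chain_union_shrink.
    exact: connected_shrink.
  - have MS : M \notin coordinates (shrink M V) by rewrite inS eqxx.
    move: cn; rewrite -(shrinkK uV MV Mmax MsV) coordinates_grow //.
    by rewrite cardfsU1 (shrinkK uV MV Mmax MsV) MS => -[].
  - split=> [|y]; last by rewrite inS => /andP[_ /Vmin].
    by rewrite inS oneV andbT; move: (Vmin _ M2V); clear; lia.
have shrinkMK := shrinkK uV MV Mmax MsV.
case: ifPn => M1 /=.
  rewrite subrK shrinkMK; split=> //; apply: vshrink => //.
    apply: contra M1 => M1.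
    by apply/coordinatesP; exists [fset M - 1]; rewrite ?inE.
  move=> y; rewrite inS => /andP[yM yV].
  have yM1 : y != M - 1 by apply: contraNneq M1 => <-.
  by move: (Mmax _ yV) yM yM1; clear; lia.
move: M1; rewrite negbK => M1; case: ifPn => M1V /=; last first.
  have M1S : M - 1 \in coordinates (shrink M V) by rewrite inS M1 M1M.
  rewrite (_ : M - 1 - 1 = M - 2) ?M2S ?subrK ?shrinkMK; last by clear; lia.
  split=> //; apply: vshrink => // y; rewrite inS => /andP[yM /Mmax].
  by move: yM; clear; lia.
set E := [fset M - 1] in M1V *.
have DE : D != E by apply: contraTneq MD => ->; rewrite inE eq_sym.
have VE : coordinates V = (M - 1) |` coordinates (V `\ E).
  by rewrite -coordinatesU1 fsetD1K.
have M1E : M - 1 \notin coordinates (V `\ E).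
  apply/negP => /coordinatesP[C]; rewrite !inE => /andP[CE CV] CM1.
  case/eqP: CE; apply: (chain_union_eq uV CV M1V CM1).
  by rewrite inE.
have inE' y : y \in coordinates V -> y != M - 1 -> y \in coordinates (V `\ E).
  by rewrite VE !inE => /predU1P[->|]; rewrite ?eqxx.
have EV y : y \in coordinates (V `\ E) -> y \in coordinates V.
  by rewrite VE !inE orbC => ->.
rewrite (negPf M1E) fsetD1K //; split=> //; split=> /=.
- apply/interlacedP; split.
    split=> [C|C F]; rewrite !inE; first by move=> /andP[_ /uV.1].
    by move=> /andP[_ CV] /andP[_ FV]; exact: uV.2.
  (* The chain [E] can only be linked to the chain containing [M], namely [D]. Sending [E] to [D]
     therefore collapses the links at [E] and keeps all others. *)
  have nbr C : C \in V -> straddles E C \/ straddles C E -> C = D.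
    move=> CV [] [y []]; rewrite !inE; last by clear; lia.
    move=> /eqP-> _; rewrite subrK => MC.
    exact: chain_union_eq uV CV DV MC MD.
  apply: (connected_image (f := fun C => if C == E then D else C)) cV.
  + by move=> C CV; case: eqVneq => [_|CE]; rewrite !inE ?DE ?CE.
  + move=> C; rewrite !inE => /andP[CE CV]; exists C => //.
    by rewrite (negPf CE).
  + move=> C F CV FV CF; case: (eqVneq C E) => CE; case: (eqVneq F E) => FE.
    * by right.
    * by right; rewrite (nbr F) //; case: CF => _ _; rewrite CE.
    * by right; rewrite (nbr C) //; case: CF => _ _; rewrite FE; tauto.
    * by left.
- by move: cn; rewrite VE cardfsU1 M1E => -[].
- split=> [|y /EV/Vmin//]; apply: inE' => //.
  by move: (Vmin _ M2V); clear; lia.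
- by apply: inE' => //; rewrite eq_sym.
- by move=> y /EV/Mmax.
Qed.

(** * Coding interlaced unions by words of bits, and the count *)

(** The head of the word is the last move made, so [unstep] recovers the word from its head. *)
Definition decode (s : seq bool) : int * {fset {fset int}} :=
  foldr step (3, [fset [fset 1; 3]]) s.

(** The chain of the maximum [M] also contains [M - 2]; these two entries exhaust the coordinates,
    and the minimum [1] forces [M = 3]. *)
Lemma valid2P X : valid 2 X <-> X = (3, [fset [fset 1; 3]]).
Proof.
split=> [|->]; last first.
  split=> /=; rewrite /smallest_coordinate ?coordinates1 ?cardfs2 ?inE //.
  - apply/interlacedP; split; [split=> C|].
    + by rewrite inE => /eqP->; apply: (chain_pair 1).
    + by move=> D; rewrite !inE => /eqP-> /eqP->; rewrite eqxx.
    + by move=> P _ C D; rewrite !inE => /eqP-> /eqP->.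
  - by split=> // y; rewrite !inE => /orP[] /eqP->.
  - by move=> y; rewrite !inE => /orP[] /eqP->.
case: X => M U vU; have [D DU /andP[MD M2D]] := valid_pred (leqnn 2) vU.
have [/= [uU _] c2 [oneU Umin] MU Mmax] := vU.
have sub C : C \in U -> C `<=` coordinates U.
  by move=> CU; apply/fsubsetP => y yC; apply/coordinatesP; exists C.
have UE : [fset M - 2; M] = coordinates U.
  apply/eqP; rewrite eqEfcard c2 cardfs2 (_ : M - 2 != M) //; last lia.
  rewrite andbT; apply: fsubset_trans (sub _ DU).
  by apply/fsubsetP => y; rewrite !inE => /orP[] /eqP->.
have DE : D = [fset M - 2; M].
  apply/eqP; rewrite eqEfsubset {1}UE sub //=.
  by apply/fsubsetP => y; rewrite !inE => /orP[] /eqP->.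
have M3 : M = 3.
  have M2U : M - 2 \in coordinates U by rewrite -UE !inE eqxx.
  by move: (oneU) (Umin _ M2U); rewrite -UE !inE => /orP[] /eqP; lia.
congr (_, _) => //; apply/fsetP => C; rewrite inE.
suff -> : [fset 1; 3] = D.
  apply/idP/eqP => [CU|-> //].
  have [c [k Ck]] := uU.1 _ CU.
  have cC : c \in C by rewrite Ck; apply/in_chain_set; exists 0; lia.
  apply: (chain_union_eq uU CU DU cC).
  by rewrite DE UE; apply/coordinatesP; exists C.
by rewrite DE M3.
Qed.

Lemma valid_decode s : valid (size s).+2 (decode s).
Proof. by elim: s => [|b s IH]; [apply/valid2P|exact: valid_step]. Qed.

Lemma decode_inj s t : size s = size t -> decode s = decode t -> s = t.
Proof.
elim: s t => [|b s IH] [|c t] //= [st] /(congr1 unstep).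
by rewrite !(stepK _ _ (valid_decode _)) // => -[-> /IH->].
Qed.

Lemma decode_surj m X : valid m.+2 X -> exists2 s, size s = m & decode s = X.
Proof.
elim: m X => [|m IH] X vX; first by exists [::] => //; apply/esym/valid2P.
have [/IH[s sm ds] sX] := unstepK (isT : (2 <= m.+2)%N) vX.
by exists ((unstep X).1 :: s); rewrite /= ?sm ?ds.
Qed.

Lemma interlaced_valid n U : (2 <= n)%N -> interlaced U ->
  #|` coordinates U| = n -> smallest_coordinate U 1 -> exists M, valid n (M, U).
Proof.
move=> n2 iU cn sU.
have [M MU Mmax] : exists2 M, M \in coordinates U &
    forall y, y \in coordinates U -> y <= M.
  have [i _ imax] := arg_maxP (fun i : coordinates U => val i)
    (isT : predT [` sU.1]).
  by exists (val i) => [|y yU]; [exact: valP|exact: (imax [` yU])].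
by exists M.
Qed.

Local Open Scope classical_set_scope.
Local Open Scope card_scope.
Local Open Scope ring_scope.

Theorem corollary3p9 (n : nat) (hn : (2 <= n)%N) :
  [set U : {fset {fset int}} |
      [/\ interlaced U, #|` coordinates U| = n & smallest_coordinate U 1]]
    #= `I_(2 ^ (n - 2))%N.
Proof.
have nE : n = (n - 2).+2 by lia.
set T := [set U | _].
(* The base chain has two coordinates and each bit adds one, hence words of length [n - 2]. *)
have -> : T = [set` [fset (decode (tval s)).2 | s in {: (n - 2).-tuple bool}]%fset].
  apply/seteqP; split=> U /=.
    move=> [iU cn sU]; have [M] := interlaced_valid hn iU cn sU.
    rewrite {1}nE => /decode_surj[s /eqP sz dE].
    by apply/imfsetP; exists (Tuple sz); rewrite //= dE.
  case/imfsetP => /= s _ ->; have := valid_decode s.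
  by rewrite size_tuple -nE => -[].
apply/card_eq_fsetP; rewrite card_imfset /=; last first.
  move=> s t /= st; apply: val_inj; apply: decode_inj; first by rewrite !size_tuple.
  (* Only the unions are known to agree; the first components agree as well, both being the largest
     coordinate of this union. *)
  have [_ _ _ sM sV] := valid_decode s; have [_ _ _ tM tV] := valid_decode t.
  rewrite [LHS]surjective_pairing [RHS]surjective_pairing -st; congr pair.
  by apply/eqP; rewrite eq_le tV ?sV // -?st // st.
by rewrite -cardE card_tuple card_bool.
Qed.
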